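(* Let $M$ be an infinite (countably indexed) irreducible non-negative matrix with $\lambda(M)<\infty$. Assume that the digraph of $M$ admits a finite cycle transversal and that $\lambda(M)-\lambda_n(M)=o(n^{-1})$ as $n\to\infty$. Then $M$ is recurrent.
   Context: The digraph of a matrix has the index-set as vertex-set, and $(v,w)$ is an arc if and only if the $(v,w)$ entry is non-zero (loops allowed). A matrix is irreducible if its digraph is strongly connected, i.e. for any two distinct vertices $v,w$ there is a directed path from $v$ to $w$. A cycle transversal of a digraph is a set of vertices whose deletion (with all incident arcs) leaves a digraph with no directed cycles (loops count as cycles of length 1, pairs of opposite arcs as cycles of length 2). For an infinite entrywise non-negative matrix $M$, $\lambda_n(M)$ is the supremum of the spectral radii of its principal submatrices of order $n$, and $\lambda(M)=\lim_{n\to\infty}\lambda_n(M)$, i.e. the supremum of the spectral radii of all finite principal submatrices. $M$ with $\lambda(M)<\infty$ is transient if the series $\sum_{p=0}^{\infty}M^pz^{-p}$ converges entrywise at $z=\lambda(M)$ (it always converges for $z>\lambda(M)$), and recurrent otherwise. *)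

(* Defs.v *)
From mathcomp Require Import all_boot all_order all_algebra finmap complex.
From mathcomp Require Import all_classical all_reals all_analysis.

Set Implicit Arguments.
Unset Strict Implicit.
Unset Printing Implicit Defensive.

Import Order.TTheory GRing.Theory Num.Theory.
Import numFieldNormedType.Exports.

Local Open Scope classical_set_scope.
Local Open Scope ring_scope.

Definition spectral_radius (R : realType) (n : nat) (A : 'M[R]_n) : R :=
  sup [set Normc.normc mu |
    mu in [set mu : R[i] | eigenvalue (map_mx (real_complex R) A) mu]].

Definition digraph_of (R : realType) (I : countType) (M : I -> I -> R) : rel I :=
  fun v w => M v w != 0.

Definition irreducible (R : realType) (I : countType) (M : I -> I -> R) : Prop :=
  forall v w, v != w -> exists p : seq I, path (digraph_of M) v p /\ last v p = w.

(* Isolating the vertices of S instead of removing them from the vertex type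
   leaves the same directed cycles. *)
Definition del_vertices (I : countType) (e : rel I) (S : {fset I}) : rel I :=
  fun v w => [&& v \notin S, w \notin S & e v w].

(* The empty sequence vacuously satisfies [ucycle]; it is not a cycle. A
   singleton [:: v] is a cycle when v carries a loop. *)
Definition acyclic (I : countType) (e : rel I) : Prop :=
  forall c : seq I, ucycle e c -> c = [::].

Definition cycle_transversal (I : countType) (e : rel I) (S : {fset I}) : Prop :=
  acyclic (del_vertices e S).

(* The principal submatrix on the range of an injective f. Enumerating the same
   index subset in another order conjugates it by a permutation matrix, which
   does not affect the spectral radius. *)
Definition principal_submx (R : realType) (I : countType) (M : I -> I -> R)
    (n : nat) (f : 'I_n -> I) : 'M[R]_n :=
  \matrix_(i, j) M (f i) (f j).

Definition lambda_n (R : realType) (I : countType) (M : I -> I -> R) (n : nat) :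
    \bar R :=
  ereal_sup [set (spectral_radius (principal_submx M f))%:E |
    f in [set f : 'I_n -> I | injective f]].

Definition lambda (R : realType) (I : countType) (M : I -> I -> R) : \bar R :=
  limn (lambda_n M).

(* Entries of M^p for non-negative M: the sums over the infinite index set are
   taken in [0, +oo]. *)
Fixpoint mxpow (R : realType) (I : countType) (M : I -> I -> R) (p : nat)
    (u v : I) : \bar R :=
  if p is p'.+1 then \esum_(w in [set: I]) ((M u w)%:E * mxpow M p' w v)%E
  else ((u == v)%:R)%:E.

(* For non-negative M and z > 0 all terms lie in [0, +oo], so the series
   converges to a real number iff its sum in the extended reals is finite. *)
Definition power_series_cvg (R : realType) (I : countType)
    (M : I -> I -> R) (z : R) : Prop :=
  forall u v, (\sum_(0 <= p <oo) (mxpow M p u v * (z ^- p)%:E) < +oo)%E.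

Definition transient (R : realType) (I : countType) (M : I -> I -> R) : Prop :=
  (lambda M < +oo)%E /\ power_series_cvg M (fine (lambda M)).

Definition recurrent (R : realType) (I : countType) (M : I -> I -> R) : Prop :=
  (lambda M < +oo)%E /\ ~ power_series_cvg M (fine (lambda M)).

(* Main.v *)
Require Import Defs.
From mathcomp Require Import all_boot all_order all_algebra finmap complex.
From mathcomp Require Import all_classical all_reals all_analysis.
From mathcomp Require Import ring lra zify.

(** Suppose the power series converges at [z = lambda M], and let [h v] be the
    sum over a finite nonempty set containing the transversal [S] of the Green
    functions of [M] at [z]. Then [h > 0] and [M h <= z (h - 1_S)], hence
    [M h <= z (1 - d) h] on [S] for some constant [d > 0]. In a principal
    submatrix of order [n], the digraph outside [S] is acyclic, so its vertices
    have heights [e < n] increasing along arcs; put [e = n] on [S]. With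
    [t = 1 - d / (n + 1)], Bernoulli gives [1 - d <= t ^ (n + 1)], and the tilted
    vector [h t ^ e] satisfies [A (h t ^ e) <= z t (h t ^ e)]. Therefore
    [lambda_n <= z (1 - d / (n + 1))], which contradicts the rate [o(1/n)]. *)

Import Order.TTheory GRing.Theory Num.Theory.
Import numFieldNormedType.Exports.
Set Implicit Arguments.
Unset Strict Implicit.
Unset Printing Implicit Defensive.
Local Open Scope classical_set_scope.
Local Open Scope ring_scope.

(** * Spectral radii of finite non-negative matrices *)

Section SpectralRadius.
Context {R : realType}.
Implicit Types (n m : nat) (c : R).

Lemma normc_sum_le (J : Type) (r : seq J) (P : pred J) (F : J -> R[i]) :
  Normc.normc (\sum_(j <- r | P j) F j) <= \sum_(j <- r | P j) Normc.normc (F j).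
Proof.
rewrite -lecR rmorph_sum; exact: (@ler_norm_sum R[i] _ J r F P).
Qed.

Lemma normc_exp (z : R[i]) m : Normc.normc (z ^+ m) = Normc.normc z ^+ m.
Proof.
by elim: m => [|m IH]; rewrite ?expr0 ?Normc.normc1// !exprS Normc.normcM IH.
Qed.

Lemma normc_real (x : R) : 0 <= x -> Normc.normc (real_complex R x) = x.
Proof. by move=> x0; rewrite /= expr0n addr0 sqrtr_sqr ger0_norm. Qed.

Lemma normc_ge0 (z : R[i]) : 0 <= Normc.normc z.
Proof. by case: z => a b; exact: sqrtr_ge0. Qed.

(** Take a left eigenvector [u] and put [x = |u|]. Then [|mu| x <= x A] entrywise, so pairing with
    [h] gives [|mu| (x h) <= x A h <= c (x h)], and [x h > 0] can be cancelled. *)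
Lemma eigenvalue_le_superharmonic n (A : 'M[R]_n) (h : 'I_n -> R) c (mu : R[i]) :
  (forall i j, 0 <= A i j) -> (forall i, 0 < h i) ->
  (forall i, \sum_j A i j * h j <= c * h i) ->
  eigenvalue (map_mx (real_complex R) A) mu -> Normc.normc mu <= c.
Proof.
move=> A0 h0 Ah /eigenvalueP[u uA u0].
pose x i := Normc.normc (u 0 i).
have x0 i : 0 <= x i by exact: normc_ge0.
have xA j : Normc.normc mu * x j <= \sum_i x i * A i j.
  rewrite -Normc.normcM.
  have -> : mu * u 0 j = \sum_i u 0 i * real_complex R (A i j).
    move/matrixP/(_ 0 j): uA; rewrite !mxE => <-.
    by apply: eq_bigr => i _; rewrite mxE.
  apply: (le_trans (normc_sum_le _ _ _)); apply: ler_sum => i _.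
  by rewrite Normc.normcM normc_real.
have xh : 0 < \sum_j x j * h j.
  have [i ui] : exists i, u 0 i != 0.
    apply/existsP; apply: contra_neqT u0; rewrite negb_exists => /forallP ui.
    by apply/rowP => i; rewrite mxE; apply/eqP; rewrite -[_ == _]negbK ui.
  rewrite (bigD1 i)//= ltr_wpDr//.
    by apply: sumr_ge0 => j _; rewrite mulr_ge0// ltW.
  rewrite mulr_gt0// lt_neqAle x0 andbT eq_sym.
  by apply: contra_neq ui; exact: Normc.eq0_normc.
rewrite -(ler_pM2r xh) !mulr_sumr.
apply: (@le_trans _ _ (\sum_j (\sum_i x i * A i j) * h j)).
  by apply: ler_sum => j _; rewrite mulrA ler_wpM2r// ltW.
under eq_bigr do rewrite mulr_suml.
rewrite exchange_big/=; apply: ler_sum => i _.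
under eq_bigr do rewrite -mulrA.
by rewrite -mulr_sumr mulrCA ler_wpM2l.
Qed.

Lemma spectral_radius_le_superharmonic n (A : 'M[R]_n) (h : 'I_n -> R) c :
  0 <= c -> (forall i j, 0 <= A i j) -> (forall i, 0 < h i) ->
  (forall i, \sum_j A i j * h j <= c * h i) ->
  spectral_radius A <= c.
Proof.
move=> c0 A0 h0 Ah; rewrite /spectral_radius; set E := [set _ | _ in _].
(* A matrix of order 0 has no eigenvalue and [sup] is then 0, whence the hypothesis [0 <= c]. *)
have [->|/set0P E0] := eqVneq E set0; first by rewrite sup0.
apply: ge_sup => // _ [mu /= Amu <-].
exact: eigenvalue_le_superharmonic Amu.
Qed.

Lemma spectral_radius_ge0 n (A : 'M[R]_n) : 0 <= spectral_radius A.
Proof.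
rewrite /spectral_radius; set E := [set _ | _ in _].
have [[E0 Eub]|/sup_out ->//] := pselect (has_sup E).
have [x Ex] := E0; apply: (@le_trans _ _ x); last exact: ub_le_sup.
by case: Ex => mu _ <-; exact: normc_ge0.
Qed.

Lemma eigenvalue_le_spectral_radius n (A : 'M[R]_n) (mu : R[i]) :
  (forall i j, 0 <= A i j) ->
  eigenvalue (map_mx (real_complex R) A) mu -> Normc.normc mu <= spectral_radius A.
Proof.
move=> A0 Amu; apply: ub_le_sup; last by exists mu.
(* The [sup] is meaningful only for a bounded set. The constant vector 1 shows that the sum of all
   entries bounds every eigenvalue. *)
exists (\sum_i \sum_j A i j) => _ [nu /= Anu <-].
apply: (@eigenvalue_le_superharmonic _ A (fun=> 1)) => // i.
rewrite /= mulr1; under eq_bigr do rewrite mulr1.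
rewrite [leRHS](bigD1 i)//= lerDl.
by apply: sumr_ge0 => k _; apply: sumr_ge0.
Qed.

Lemma trig_exp (F : comNzRingType) n (T : 'M[F]_n) m : is_trig_mx T ->
  is_trig_mx (T ^+ m) /\ (forall i, (T ^+ m) i i = T i i ^+ m).
Proof.
move=> /is_trig_mxP T0; elim: m => [|m [/is_trig_mxP Tm0 Tmd]].
  split=> [|i]; last by rewrite !expr0 mxE eqxx.
  by rewrite expr0; exact: scalar_mx_is_trig.
have E i j : (T ^+ m.+1) i j = \sum_k T i k * (T ^+ m) k j.
  by rewrite exprS mxE.
split=> [|i].
  apply/is_trig_mxP => i j ij; rewrite E big1// => k _.
  have [ik|ki] := ltnP i k; first by rewrite T0// mul0r.
  by rewrite Tm0 ?mulr0// (leq_ltn_trans ki).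
rewrite E (bigD1 i)//= Tmd exprS big1 ?addr0// => k ki.
have [ik|ik|/val_inj ik] := ltngtP i k; last by rewrite ik eqxx in ki.
  by rewrite T0// mul0r.
by rewrite Tm0// mulr0.
Qed.

Lemma mx_exp_ge0 n (A : 'M[R]_n) m : (forall i j, 0 <= A i j) ->
  forall i j, 0 <= (A ^+ m) i j.
Proof.
move=> A0; elim: m => [|m IH] i j; first by rewrite expr0 mxE ler0n.
by rewrite exprS mxE; apply: sumr_ge0 => l _; rewrite mulr_ge0.
Qed.

(** By Schur, [B] is similar to a triangular matrix. Its diagonal entries are eigenvalues, and the
    trace of [B ^+ m] is the sum of their [m]-th powers. *)
Lemma normc_trace_exp_le n (B : 'M[R[i]]_n) m c :
  (forall mu, eigenvalue B mu -> Normc.normc mu <= c) ->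
  Normc.normc (\tr (B ^+ m)) <= n%:R * c ^+ m.
Proof.
case: n B => [|n] B Bc; first by rewrite mul0r /mxtrace big_ord0 Normc.normc0.
have [P /unitarymx_unit Pu Ptrig] := Schur B (ltn0Sn n).
have {}Bc mu : eigenvalue (conjmx P B) mu -> Normc.normc mu <= c.
  move=> Bmu; apply: Bc; move: mu Bmu.
  by apply: eigenvalue_conjmx; rewrite ?row_free_unit ?stablemx_unit.
have -> : \tr (B ^+ m) = \tr (conjmx P B ^+ m).
  have -> : conjmx P B ^+ m = P *m B ^+ m *m invmx P.
    rewrite conjumx//; elim: m => [|k IH].
      by rewrite !expr0 mulmx1 mulmxV.
    by rewrite !exprS IH -!mulmxE !mulmxA mulmxKV.
  by rewrite mxtrace_mulC mulmxA mulVmx// mul1mx.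
have {Ptrig} : is_trig_mx (conjmx P B) by [].
move: (conjmx P B) Bc => T Tc Ttrig.
have [_ Td] := trig_exp m Ttrig.
apply: (le_trans (normc_sum_le _ _ _)).
rewrite mulr_natl -[X in _ *+ X]card_ord -sumr_const.
apply: ler_sum => i _; rewrite Td normc_exp.
have Ti : Normc.normc (T i i) <= c.
  apply: Tc; rewrite eigenvalue_root_char char_poly_trig// (bigD1 i)//=.
  by rewrite rootM root_XsubC eqxx.
have Ti0 := normc_ge0 (T i i).
by apply: lerXn2r; rewrite ?nnegrE// (le_trans Ti0).
Qed.

Lemma trace_exp_le n (A : 'M[R]_n) m : (forall i j, 0 <= A i j) ->
  \tr (A ^+ m) <= n%:R * spectral_radius A ^+ m.
Proof.
move=> A0.
have tr0 : 0 <= \tr (A ^+ m).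
  by apply: sumr_ge0 => i _; exact: mx_exp_ge0.
have /(@normc_trace_exp_le _ _ m) :=
  fun mu => @eigenvalue_le_spectral_radius n A mu A0.
suff -> : map_mx (real_complex R) A ^+ m = map_mx (real_complex R) (A ^+ m).
  by rewrite trace_map_mx normc_real.
by elim: m {tr0} => [|m IH]; rewrite ?map_mx1// !exprS IH -!mulmxE map_mxM.
Qed.

End SpectralRadius.

(** * Green functions, walks and principal submatrices *)

Section InfiniteMatrix.
Context {R : realType} {I : countType} (M : I -> I -> R).
Context (M_ge0 : forall v w, 0 <= M v w).

(** Formally the entries of the inverse of [1 - M / z]; [power_series_cvg] says that all of them are
    finite. *)
Definition green (z : R) (u v : I) : \bar R :=
  (\sum_(0 <= p <oo) (mxpow M p u v * (z ^- p)%:E))%E.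

Lemma mxpow_ge0 p u v : (0 <= mxpow M p u v)%E.
Proof.
elim: p u => [|p IH] u /=; first by rewrite lee_fin ler0n.
by apply: esum_ge0 => w _; rewrite mule_ge0// lee_fin.
Qed.

Lemma green_term_ge0 z p u v : 0 < z -> (0 <= mxpow M p u v * (z ^- p)%:E)%E.
Proof.
by move=> z0; rewrite mule_ge0 ?mxpow_ge0// lee_fin invr_ge0 exprn_ge0// ltW.
Qed.

Lemma green_ge0 z u v : 0 < z -> (0 <= green z u v)%E.
Proof. by move=> z0; apply: nneseries_ge0 => p _ _; exact: green_term_ge0. Qed.

(** Splitting off the term [p = 0] gives [z G = z 1 + M G]. Restricting the product [M G] to the
    finitely many indices in [s] leaves an inequality. *)
Lemma green_superharmonic z u v (s : seq I) : 0 < z -> uniq s ->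
  (z%:E * ((u == v)%:R)%:E + \sum_(w <- s) (M u w)%:E * green z w v
    <= z%:E * green z u v)%E.
Proof.
move=> z0 s_uniq.
rewrite [green z u v]/green nneseries_recl//; last first.
  by move=> k _; exact: green_term_ge0.
rewrite /= expr0 invr1 mule1 ge0_muleDr ?lee_fin ?ler0n//; last first.
  by apply: nneseries_ge0 => p _ _; exact: green_term_ge0.
rewrite leeD2l// -nneseries_addn; last by move=> k; exact: green_term_ge0.
rewrite -nneseriesZl; last by move=> k _; exact: green_term_ge0.
under eq_bigr => w _.
  rewrite /green -nneseriesZl; last by move=> k _; exact: green_term_ge0.
  over.
rewrite -nneseries_sum; last first.
  by move=> w k _; rewrite mule_ge0 ?green_term_ge0 ?lee_fin.
apply: lee_nneseries => [k _ _|k _].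
  by apply: sume_ge0 => w _; rewrite mule_ge0 ?green_term_ge0 ?lee_fin.
under eq_bigr do rewrite muleA.
rewrite -ge0_sume_distrl; last first.
  by move=> w _; rewrite mule_ge0 ?mxpow_ge0 ?lee_fin.
rewrite muleCA -EFinM addn1 exprS invfM mulVKf ?gt_eqF//.
apply: lee_pmul => //=.
- by apply: sume_ge0 => w _; rewrite mule_ge0 ?mxpow_ge0 ?lee_fin.
- by rewrite lee_fin invr_ge0 exprn_ge0// ltW.
- apply: esum_ge; exists [set` s]; first by split; [exact: finite_seq|].
  by rewrite fsbig_seq.
Qed.

Definition walk_weight (v : I) (p : seq I) : R :=
  \prod_(e <- zip (v :: p) p) M e.1 e.2.

Lemma walk_weight_cons v w p : walk_weight v (w :: p) = M v w * walk_weight w p.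
Proof. by rewrite /walk_weight /= big_cons. Qed.

Lemma walk_weight_gt0 v p : path (digraph_of M) v p -> 0 < walk_weight v p.
Proof.
elim: p v => [|w p IH] v /=; first by rewrite /walk_weight /= big_nil.
case/andP=> vw /IH p0.
by rewrite walk_weight_cons mulr_gt0// lt_neqAle eq_sym M_ge0 andbT.
Qed.

(** An entry of a power is the sum of the weights of all walks of that length; a single one is
    kept. *)
Lemma principal_exp_ge n (f : 'I_n -> I) i q :
  walk_weight (f i) (map f q) <= (principal_submx M f ^+ size q) i (last i q).
Proof.
elim: q i => [|j q IH] i /=.
  by rewrite /walk_weight big_nil expr0 mxE eqxx.
rewrite walk_weight_cons exprS mxE (bigD1 j)//= -[leLHS]addr0 lerD//.
  by rewrite mxE ler_wpM2l.
have A0 k l : 0 <= principal_submx M f k l by rewrite mxE.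
by apply: sumr_ge0 => k _; rewrite mulr_ge0 ?mx_exp_ge0.
Qed.

Lemma closed_walk_radius n (f : 'I_n -> I) i q : last i q = i ->
  walk_weight (f i) (map f q) <=
    n%:R * spectral_radius (principal_submx M f) ^+ size q.
Proof.
move=> iq; have A0 k l : 0 <= principal_submx M f k l by rewrite mxE.
apply: (le_trans (principal_exp_ge f i q)); rewrite iq.
apply: le_trans (trace_exp_le _ A0).
rewrite /mxtrace [leRHS](bigD1 i)//= lerDl.
by apply: sumr_ge0 => k _; exact: mx_exp_ge0.
Qed.

Context (I_infinite : infinite_set [set: I]).

Lemma infinite_fresh (s : seq I) : exists v, v \notin s.
Proof.
apply: contrapT => /forallNP sE; apply: I_infinite.
by apply: (sub_finite_set _ (finite_seq s)) => v _ /=; exact/negPn/negP/sE.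
Qed.

Lemma infinite_enum (s : seq I) n : (size s <= n)%N ->
  exists2 f : 'I_n -> I, injective f & forall v, v \in s -> exists i, f i = v.
Proof.
move=> sn; suff [t [tu tn st]] : exists t, [/\ uniq t, size t = n & {subset s <= t}].
  have [v0 _] := infinite_fresh [::].
  exists (fun i => nth v0 t i) => [i j /eqP|v /st vt].
    by rewrite nth_uniq ?tn// => /eqP/val_inj.
  have vn : (index v t < n)%N by rewrite -tn index_mem.
  by exists (Ordinal vn); rewrite /= nth_index.
have {sn} : (size (undup s) <= n)%N := leq_trans (size_undup s) sn.
move/subnK <-; elim: (n - _)%N => [|k [t [tu tn st]]].
  exists (undup s); rewrite undup_uniq; split=> // v.
  by rewrite mem_undup.
have [v vt] := infinite_fresh t.
exists (v :: t); rewrite /= vt tu tn; split=> // w /st wt.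
by rewrite inE wt orbT.
Qed.

End InfiniteMatrix.

(** The height of [i] is the number of vertices not reachable from [i]. Along an arc from [i] to [j]
    the reachable set loses [i], since a path back from [j] would close a cycle. *)
Lemma acyclic_height (T : finType) (E : rel T) :
  (forall c : seq T, ucycle E c -> c = [::]) ->
  exists e : T -> nat,
    (forall i, e i < #|T|)%N /\ (forall i j, E i j -> (e i < e j)%N).
Proof.
move=> acE; exists (fun i => #|T| - #|connect E i|)%N; split=> [i|i j Eij].
  have i_i : (0 < #|connect E i|)%N by apply/card_gt0P; exists i; exact: connect0.
  by rewrite ltn_subrL i_i (leq_trans i_i) ?max_card.
have /proper_card ji : connect E j \proper connect E i.
  apply/properP; split.
    by apply/fintype.subsetP => k; apply: connect_trans; exact: connect1.
  exists i; first exact: connect0.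
  apply/negP => /connectP[p Ep ip]; move: ip Eij.
  case/shortenP: Ep => q Eq q_uniq _ iq Eij.
  suff : j :: q = [::] by [].
  by apply: acE; rewrite /ucycle q_uniq /= rcons_path Eq -iq Eij.
by rewrite ltn_sub2l// (leq_trans ji) ?max_card.
Qed.

Lemma bernoulli_le (F : realFieldType) (x : F) n : 0 <= x <= 1 ->
  1 - n%:R * x <= (1 - x) ^+ n.
Proof.
move=> /andP[x0 x1]; elim: n => [|n IH]; first by rewrite mul0r subr0 expr0.
rewrite exprS; apply: (@le_trans _ _ ((1 - x) * (1 - n%:R * x))); last first.
  by rewrite ler_wpM2l// subr_ge0.
have : 0 <= n%:R * x * x by rewrite !mulr_ge0.
by rewrite -natr1; lra.
Qed.

(** * Positivity of the limit and the tilted superharmonic vector *)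

Section Irreducible.
Context {R : realType} {I : countType} (M : I -> I -> R).
Context (M_ge0 : forall v w, 0 <= M v w).
Context (I_infinite : infinite_set [set: I]).
Context (M_irreducible : irreducible M).

Lemma closed_walk :
  exists v p, [/\ path (digraph_of M) v p, last v p = v & p != [::]].
Proof.
have [v _] := infinite_fresh I_infinite [::].
have [w] := infinite_fresh I_infinite [:: v]; rewrite inE => wv.
have [p [vp pw]] := M_irreducible wv.
have [q [wq qv]] : exists q, path (digraph_of M) v q /\ last v q = w.
  by apply: M_irreducible; rewrite eq_sym.
exists w, (p ++ q); rewrite cat_path last_cat pw vp wq qv; split=> //.
by case: p pw {vp} => //= wv'; rewrite wv' eqxx in wv.
Qed.

Lemma spectral_radius_lower_bound :
  exists (c : R) (N : nat), 0 < c /\ forall n, (N <= n)%N -> exists f : 'I_n -> I,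
    injective f /\ c <= n%:R * spectral_radius (principal_submx M f).
Proof.
have [v [p [vp pv p0]]] := closed_walk.
(* A closed walk of weight [w] and length [k > 0] gives [w <= n rho ^ k]. If [rho <= 1], then
   [rho ^ k <= rho] and [w <= n rho]; otherwise [1 <= n rho]. The threshold on [n] leaves room for
   the whole walk. *)
exists (Num.min 1 (walk_weight M v p)), (size (v :: p)).
split=> [|n pn]; first by rewrite lt_min ltr01 walk_weight_gt0.
have [f f_inj fP] := infinite_enum I_infinite pn; exists f; split=> //.
have [q qp] : exists q, map f q = p.
  have : {subset p <= v :: p} by move=> w; rewrite inE orbC => ->.
  elim: {1 3}p => [|w r IH] rp; first by exists [::].
  have [q <-] : exists q, map f q = r.
    by apply: IH => x xr; apply: rp; rewrite inE xr orbT.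
  have [i <-] := fP w (rp w (mem_head _ _)).
  by exists (i :: q).
have [i iv] := fP v (mem_head _ _).
have iq : last i q = i by apply: f_inj; rewrite -last_map qp iv.
have := closed_walk_radius M_ge0 f iq; rewrite qp iv => wle.
set rho := spectral_radius _ in wle *.
have n1 : 1 <= n%:R :> R by rewrite ler1n (leq_trans _ pn).
have [rho1|/ltW rho1] := leP rho 1; last first.
  by rewrite ge_min; apply/orP; left; rewrite mulr_ege1.
rewrite ge_min; apply/orP; right; apply: (le_trans wle).
rewrite ler_wpM2l// ler_iXnr//; last exact: spectral_radius_ge0.
by move: p0; rewrite -qp; case: (q).
Qed.

(* Positivity is needed because at [z = 0] the junk value [0^-1 = 0] makes the
   power series converge. The bound [lambda_n >= c / n], coming from the trace
   of a power along a closed walk, is weak but already beats [o(1/n)]; if it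
   fails to contradict the rate, it is because [fine +oo = 0], and then the
   limit is infinite. *)
Lemma lambda_gt0 : (lambda M < +oo)%E ->
  (fun n : nat => fine (lambda M) - fine (lambda_n M n))
    =o_\oo (fun n : nat => n%:R^-1 : R) ->
  0 < fine (lambda M).
Proof.
move=> lambda_lty lambda_rate.
rewrite ltNge; apply/negP => lambda_le0.
have [c [N [c0 cP]]] := spectral_radius_lower_bound.
have c20 : 0 < c / 2 by rewrite divr_gt0.
have /eqoP/(_ _ c20) lim0 := lambda_rate.
suff : lambda M = +oo%E by move=> E; rewrite E ltxx in lambda_lty.
apply/cvg_lim => //; apply: cvg_near_cst.
near=> n.
have Nn : (N.+1 <= n)%N by near: n; exact: nbhs_infty_ge.
have n0 : 0 < n%:R :> R by rewrite ltr0n (leq_trans _ Nn).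
have : ((c / n%:R)%:E <= lambda_n M n)%E.
  have [f [f_inj cf]] := cP n (ltnW Nn).
  apply: le_trans (ereal_sup_ubound _); last by exists f.
  by rewrite lee_fin ler_pdivrMr// mulrC.
have : `|fine (lambda M) - fine (lambda_n M n)| <= c / 2 * `|n%:R^-1|.
  by near: n.
rewrite ger0_norm ?invr_ge0// ler_norml => /andP[+ _].
(* A finite value [r] would satisfy [c / n <= r <= c / (2 n)], so only [+oo] remains. *)
case: (lambda_n M n) => [r| |]//=; rewrite lee_fin => rle cle.
have : 0 < c / n%:R by rewrite divr_gt0.
by move=> cn; exfalso; move: lambda_le0 cn rle cle; clear; lra.
Unshelve. all: by end_near.
Qed.

Lemma exists_superharmonic (S : seq I) z : 0 < z -> power_series_cvg M z ->
  exists h : I -> R, (forall v, 0 < h v) /\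
    forall u (s : seq I), uniq s ->
      \sum_(w <- s) M u w * h w <= z * (h u - (u \in S)%:R).
Proof.
move=> z0 Mcvg; have z_ge0 := ltW z0; have [v0 _] := infinite_fresh I_infinite [::].
pose g u v := fine (green M z u v).
have gE u v : green M z u v = (g u v)%:E.
  by rewrite fineK// ge0_fin_numE ?green_ge0//; exact: Mcvg.
have g0 u v : 0 <= g u v by rewrite fine_ge0// green_ge0.
have gle u v s : uniq s ->
    \sum_(w <- s) M u w * g w v <= z * (g u v - (u == v)%:R).
  move=> /(green_superharmonic M_ge0 u v z0); rewrite gE.
  under eq_bigr do rewrite gE -EFinM.
  rewrite sumEFin -!EFinM -EFinD lee_fin mulrBr => H; lra.
(* Adding [v0] keeps [h] from vanishing when [S] is empty. *)
pose T := undup (v0 :: S); pose h v := \sum_(s <- T) g v s.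
have h_ge0 v : 0 <= h v by apply: sumr_ge0.
have hle u s : uniq s -> \sum_(w <- s) M u w * h w <= z * (h u - (u \in T)%:R).
  move=> s_uniq; under eq_bigr do rewrite mulr_sumr.
  rewrite exchange_big/=.
  have -> : (u \in T)%:R = \sum_(v <- T) (u == v)%:R :> R.
    have [uT|uT] := boolP (u \in T).
      rewrite (bigD1_seq u) ?undup_uniq//= eqxx big1 ?addr0// => v.
      by rewrite eq_sym => /negPf ->.
    by rewrite big_seq big1// => v vT; case: eqP => // uv; rewrite uv vT in uT.
  by rewrite -sumrB mulr_sumr; apply: ler_sum => v _; exact: gle.
have hmono u v : h v * M u v <= z * h u.
  have := @hle u [:: v] isT; rewrite big_seq1 mulrC => /le_trans; apply.
  by rewrite ler_wpM2l// gerBl ler0n.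
have hv0 : 0 < h v0.
  have := @hle v0 [::] isT; rewrite big_nil pmulr_rge0// subr_ge0.
  by apply: lt_le_trans; rewrite mem_undup mem_head ltr01.
exists h; split=> [v|u s /hle/le_trans]; last first.
  apply; rewrite ler_wpM2l// lerD2l lerN2 ler_nat mem_undup inE.
  by case: (u \in S); rewrite ?orbT.
have [->//|/eqP/eqP vv0] := eqVneq v v0.
have [p [+ pv0]] := M_irreducible vv0.
(* Positivity spreads backwards along a path from [v] to [v0], because [h w * M v w <= z * h v]. *)
elim: p v pv0 {vv0} => [|w p IH] v /=; first by move=> ->.
move=> /IH{}IH /andP[vw /IH hw].
rewrite -(pmulr_rgt0 _ z0); apply: lt_le_trans (hmono v w).
by rewrite mulr_gt0// lt_neqAle M_ge0 eq_sym andbT.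
Qed.

Lemma transversal_spectral_radius (S : {fset I}) (h : I -> R) z d n (f : 'I_n -> I) :
  cycle_transversal (digraph_of M) S -> 0 <= z ->
  (forall v, 0 < h v) ->
  (forall u (s : seq I), uniq s ->
    \sum_(w <- s) M u w * h w <= z * (h u - (u \in S)%:R)) ->
  0 <= d < 1 -> (forall v, v \in S -> d * h v <= 1) -> injective f ->
  spectral_radius (principal_submx M f) <= z * (1 - d / n.+1%:R).
Proof.
move=> S_tr z0 h0 Mh /andP[d0 d1] dh f_inj.
pose E i j := del_vertices (digraph_of M) S (f i) (f j).
have [c Ec|e [en eE]] := @acyclic_height 'I_n E.
  have /S_tr : ucycle (del_vertices (digraph_of M) S) (map f c).
    by move: Ec; rewrite /ucycle map_inj_uniq// cycle_map.
  by case: (c).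
have x0 : 0 <= d / n.+1%:R by rewrite divr_ge0.
have x1 : d / n.+1%:R < 1.
  by rewrite ltr_pdivrMr// mul1r (lt_le_trans d1)// ler1n.
set t := 1 - _; have t0 : 0 < t by rewrite subr_gt0.
have t1 : t <= 1 by rewrite gerBl.
have dt : 1 - d <= t ^+ n.+1.
  have := @bernoulli_le R (d / n.+1%:R) n.+1.
  by rewrite x0 ltW// => /(_ isT); rewrite mulrC divfK ?pnatr_eq0.
(* The value [n] exceeds every height, so arcs from outside [S] into [S] also increase [e']. *)
pose e' i := if f i \in S then n else e i.
have Mh_sum i : \sum_j M (f i) (f j) * h (f j) <= z * (h (f i) - (f i \in S)%:R).
  rewrite -(big_map f xpredT (fun w => M (f i) w * h w)).
  by rewrite Mh ?map_inj_uniq ?index_enum_uniq.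
apply: (@spectral_radius_le_superharmonic _ _ _ (fun i => h (f i) * t ^+ e' i)).
- by rewrite mulr_ge0// ltW.
- by move=> i j; rewrite mxE.
- by move=> i; rewrite mulr_gt0// exprn_gt0.
move=> i; under eq_bigr do rewrite mxE.
(* Arcs leaving a vertex of [S] may lower [e'], so there the tilt is only bounded by 1. The loss is
   recovered from the defect of [h] on [S], as [h - 1 <= (1 - d) h] and [1 - d <= t * t ^+ n]. *)
have step j : M (f i) (f j) * (h (f j) * t ^+ e' j) <=
    M (f i) (f j) * h (f j) * (if f i \in S then 1 else t ^+ (e' i).+1).
  rewrite mulrA; have [->|Mij] := eqVneq (M (f i) (f j)) 0; first by rewrite !mul0r.
  apply: ler_wpM2l; first by rewrite mulr_ge0// ltW.
  have t_ge0 := ltW t0.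
  case: (boolP (f i \in S)) => iS; first by rewrite exprn_ile1.
  apply: ler_wiXn2l => //; rewrite /e' (negPf iS).
  case: (boolP (f j \in S)) => jS; first by rewrite (leq_trans (en i))// card_ord.
  by apply: eE; rewrite /E /del_vertices iS jS.
apply: (le_trans (ler_sum _ (fun j _ => step j))).
rewrite -mulr_suml; have := Mh_sum i; rewrite /e'.
case: (boolP (f i \in S)) => iS /= Mhi.
  rewrite mulr1 (le_trans Mhi)// -mulrA ler_wpM2l// mulrCA -exprS.
  apply: (@le_trans _ _ (h (f i) * (1 - d))).
    by have := dh _ iS; rewrite mulrBr mulr1 mulrC => ?; lra.
  by rewrite ler_wpM2l// ltW.
rewrite subr0 in Mhi; rewrite exprS.
rewrite (_ : z * t * _ = z * h (f i) * (t * t ^+ e i)); last by ring.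
have t_ge0 := ltW t0.
by apply: ler_wpM2r => //; rewrite mulr_ge0// exprn_ge0.
Qed.

End Irreducible.

(** * Contradiction with the convergence rate *)

Theorem corollary3 (R : realType) (I : countType) (M : I -> I -> R)
  (I_infinite : infinite_set [set: I])
  (M_ge0 : forall v w : I, 0 <= M v w)
  (M_irreducible : irreducible M)
  (lambda_lty : (lambda M < +oo)%E)
  (M_transversal : exists S : {fset I}, cycle_transversal (digraph_of M) S)
  (lambda_rate :
    (fun n : nat => fine (lambda M) - fine (lambda_n M n))
      =o_\oo (fun n : nat => n%:R^-1 : R)) :
  recurrent M.
Proof.
split=> // Mcvg; have [S S_tr] := M_transversal.
have := lambda_gt0 M_ge0 I_infinite M_irreducible lambda_lty lambda_rate.
set z := fine (lambda M) => z0.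
have [h [h0 Mh]] := exists_superharmonic M_ge0 I_infinite M_irreducible S z0 Mcvg.
(* The constant [d] is [H^-1]: the sum makes [H] dominate [h] on [S], and the summand 2 forces
   [d < 1]. *)
pose H := 2 + \sum_(v <- S) h v.
have H2 : 2 <= H by rewrite lerDl; apply: sumr_ge0 => v _; exact: ltW.
have H0 : 0 < H by rewrite (lt_le_trans _ H2).
have dh v : v \in S -> H^-1 * h v <= 1.
  move=> vS; rewrite mulrC ler_pdivrMr// mul1r /H (bigD1_seq v)//= addrCA lerDl.
  by rewrite addr_ge0//; apply: sumr_ge0 => w _; exact: ltW.
have d01 : 0 <= H^-1 < 1.
  by rewrite invr_ge0 (ltW H0) invf_lt1// (lt_le_trans _ H2)// ltr1n.
have radius n (f : 'I_n -> I) : injective f ->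
    spectral_radius (principal_submx M f) <= z * (1 - H^-1 / n.+1%:R).
  exact: (transversal_spectral_radius M_ge0 S_tr (ltW z0) h0 Mh d01 dh).
have gap n : z * H^-1 / n.+1%:R <= z - fine (lambda_n M n).
  have : (lambda_n M n <= (z * (1 - H^-1 / n.+1%:R))%:E)%E.
    by apply: ge_ereal_sup => _ [f f_inj <-]; rewrite lee_fin radius.
  have rhs0 : 0 <= z * (1 - H^-1 / n.+1%:R).
    rewrite mulr_ge0 ?(ltW z0)// subr_ge0 ler_pdivrMr// mul1r.
    have /andP[_ /ltW d1] := d01.
    by rewrite (le_trans d1)// ler1n.
  have -> : z * H^-1 / n.+1%:R = z - z * (1 - H^-1 / n.+1%:R) by ring.
  rewrite lerD2l lerN2.
  (* The bound rules out [+oo]; for [-oo], [fine] returns 0 and [rhs0] applies. *)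
  by case: (lambda_n M n).
(* The factor 3 absorbs the shift in the gap: [n + 1 < 3 n] for [n > 0]. *)
have eps0 : 0 < z * H^-1 / 3 by rewrite !mulr_gt0// invr_gt0.
have /eqoP/(_ _ eps0) near_le := lambda_rate.
near \oo => n.
have n0 : (0 < n)%N by near: n; exact: nbhs_infty_gt.
have : `|z - fine (lambda_n M n)| <= z * H^-1 / 3 * `|n%:R^-1| by near: n.
apply/negP; rewrite -ltNge; apply: lt_le_trans (ler_norm _).
apply: lt_le_trans (gap n).
rewrite ger0_norm ?invr_ge0// -mulrA ltr_pM2l ?mulr_gt0 ?invr_gt0//.
rewrite -invfM ltf_pV2 ?posrE ?mulr_gt0 ?ltr0n//.
by rewrite -natrM ltr_nat mulSn mulSn mul1n; lia.
Unshelve. all: by end_near.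
Qed.
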